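(* For every pair of convex bodies $G$ and $K$ in $\mathbb{R}^d$ satisfying $0 \in \operatorname{int} G$ and $G \subset \operatorname{int} K$, and every $\alpha > 0$, $$\widehat{M}_H(G, K; \alpha) \;\leq\; 11 \, \widehat{M}_H\!\left(K^\circ, G^\circ; \frac{3\alpha}{16}\right)^{2} M_H\!\left(K^\circ, G^\circ; \frac{3\alpha}{16}\right).$$
   Context: A convex body in $\mathbb{R}^d$ is a compact convex set with nonempty interior. For nonempty $S \subset \mathbb{R}^d$, its polar is $S^\circ = \{ y \in \mathbb{R}^d : \langle x, y\rangle \leq 1 \text{ for all } x \in S\}$. If $0 \in \operatorname{int} G$ and $G \subset \operatorname{int} K$, then $K^\circ, G^\circ$ are convex bodies with $0 \in \operatorname{int} K^\circ$ and $K^\circ \subset \operatorname{int} G^\circ$. Hilbert metric: for a convex body $L \subset \mathbb{R}^d$ with $0 \in \operatorname{int} L$ and $y \in \mathbb{R}^d$, write $f_y(x) = 1 - \langle y, x\rangle$. For $x_1, x_2 \in \operatorname{int} L$, $$\operatorname{dist}^H_L(x_1,x_2) = \frac12 \sup_{y,z \in L^\circ} \log\left( \frac{f_y(x_1)}{f_y(x_2)} \cdot \frac{f_z(x_2)}{f_z(x_1)} \right).$$ For nonempty $C \subset \operatorname{int} L$ and $x \in \operatorname{int} L$, $\operatorname{dist}^H_L(x, C) = \operatorname{dist}^H_L(C,x) = \inf_{c \in C} \operatorname{dist}^H_L(x,c)$. Packing numbers: let $S$ be a nonempty compact subset of $\operatorname{int} L$ and $\alpha > 0$. The Hilbert packing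 number $M_H(S, L; \alpha)$ is the maximum integer $N$ for which there exist $x_1, \dots, x_N \in S$ with $\operatorname{dist}^H_L(x_i,x_j) \geq \alpha$ for all $1 \leq i < j \leq N$. The Hilbert convexified packing number $\widehat{M}_H(S, L; \alpha)$ is the maximum integer $N$ for which there exists a sequence $x_1,\dots,x_N \in S$ with $\operatorname{dist}^H_L(x_j, \operatorname{conv}\{x_1,\dots,x_{j-1}\}) \geq \alpha$ for all $2 \leq j \leq N$. Both numbers are finite for every $\alpha>0$. *)

(* Defs.v *)
From mathcomp Require Import all_boot all_order all_algebra.
From mathcomp Require Import all_classical all_reals all_analysis.
Set Implicit Arguments.
Unset Strict Implicit.
Unset Printing Implicit Defensive.
Import Order.TTheory GRing.Theory Num.Theory.
Import numFieldNormedType.Exports.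
Local Open Scope classical_set_scope.
Local Open Scope ring_scope.

Definition dotv (R : realType) (d : nat) (x y : 'rV[R]_d) : R :=
  \sum_(i < d) x 0 i * y 0 i.

Definition convex_body (R : realType) (d : nat) (K : set 'rV[R]_d) : Prop :=
  [/\ compact K, convex_set K & interior K !=set0].

Definition polar (R : realType) (d : nat) (S : set 'rV[R]_d) : set 'rV[R]_d :=
  [set y | forall x, S x -> dotv x y <= 1].

Definition convex_hull (R : realType) (d : nat) (S : set 'rV[R]_d)
    : set 'rV[R]_d :=
  smallest (@convex_set R 'rV[R]_d) S.

Definition slack (R : realType) (d : nat) (y x : 'rV[R]_d) : R := 1 - dotv y x.

(* Meant for [x1], [x2] in the interior of a convex body [L] with 0 in its
   interior: every slack below is then positive and the supremum is that of a
   nonempty bounded set of reals. *)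
Definition hilbert_dist (R : realType) (d : nat) (L : set 'rV[R]_d)
    (x1 x2 : 'rV[R]_d) : R :=
  2^-1 * sup [set ln (slack y x1 / slack y x2 * (slack z x2 / slack z x1))
             | y in polar L & z in polar L].

(* Meant for nonempty [C]. *)
Definition hilbert_dist_set (R : realType) (d : nat) (L : set 'rV[R]_d)
    (x : 'rV[R]_d) (C : set 'rV[R]_d) : R :=
  inf [set hilbert_dist L x c | c in C].

(* The greatest element of a set of naturals, and 0 if there is none. *)
Definition max_nat (A : set nat) : nat := xget 0%N (A `&` ubound A).

Definition hilbert_packing (R : realType) (d : nat) (S L : set 'rV[R]_d)
    (alpha : R) : nat :=
  max_nat [set N | exists x : 'I_N -> 'rV[R]_d,
    (forall i, S (x i)) /\
    (forall i j : 'I_N, (i < j)%N -> alpha <= hilbert_dist L (x i) (x j))].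

(* The index range is 0 .. N-1, so the condition starts at the index 1. *)
Definition hilbert_convexified_packing (R : realType) (d : nat)
    (S L : set 'rV[R]_d) (alpha : R) : nat :=
  max_nat [set N | exists x : 'I_N -> 'rV[R]_d,
    (forall i, S (x i)) /\
    (forall j : 'I_N, (0 < j)%N ->
      alpha <= hilbert_dist_set L (x j)
                 (convex_hull [set x i | i in [set i : 'I_N | (i < j)%N]]))].

(* Main.v *)
Require Import Defs.
From mathcomp Require Import all_boot all_order all_algebra.
From mathcomp Require Import all_classical all_reals all_analysis.
From mathcomp Require Import ring lra.
Set Implicit Arguments.
Unset Strict Implicit.
Unset Printing Implicit Defensive.
Import Order.TTheory GRing.Theory Num.Theory.
Import numFieldNormedType.Exports.
Local Open Scope classical_set_scope.
Local Open Scope ring_scope.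

(** The proof dualises a convexified packing [x_1, ..., x_N] of [G] into points of
    [polar K]. Write [b] for [3 alpha / 16], [F y x] for [slack y x], and [n], [M]
    for the convexified packing number and the packing number of [polar K] in
    [polar G] at scale [b].

    A minimax argument ([separating_pair]) turns the distance from [x_j] to the
    hull of its predecessors into one pair [y_j], [z_j] of points of [polar K]
    such that, for all [i < j],
      [exp (6 b) * F y_j x_i * F z_j x_j < F z_j x_i * F y_j x_j].
    A maximal packing of [polar K] is a [b]-net of size [M] ([packing_cover]), so
    at the cost of a factor [exp (2 b)] every [z_j] is replaced by a point [p_j]
    of the net. The numbers [a_j = ln (F y_j x_j / F p_j x_j)] are less than
    [2 b n] in absolute value, because a segment that is long in the Hilbert
    metric carries a large convexified packing ([ln_slack_ratio_lt]). They are
    sorted into [2 n] bins of length [2 b].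

    For [i < j] with the same point of the net and the same bin, these estimates
    combine into
      [exp (2 b) * F y_j x_i <= F y_i x_i].
    Thus, among the indices of one class, [x_i] separates [y_i] from all [y_j] of
    larger index, with ratio [exp (2 b)]; comparing the functionals given by
    [x_i] and by 0, whose slack is constant, shows that [y_i] is at distance at
    least [b] from their hull ([far_from_hull]). Read in decreasing order of the
    index, a class is therefore a convexified packing of [polar K] and has at
    most [n] members ([separated_class_le]). There are [M * 2 n] classes, whence
    [N <= 2 n ^ 2 M].

    All this presupposes that the packing numbers of [polar K] are finite and
    that the suprema defining the distances are finite. Both follow from a
    Lipschitz estimate of the Hilbert metric by the norm on [polar K]
    ([polar_hilbert_lipschitz]), which rests on the compactness of [G] in the
    interior of [K]. *)

(** * Convex sets and slacks *)

(** Interface to the interval-typed weights of [convex_set]. *)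
Lemma convex_setP (R : realType) (V : lmodType R) (A : set V) :
  convex_set A <->
  forall x y (t : R), 0 <= t <= 1 -> A x -> A y -> A (t *: x + (1 - t) *: y).
Proof.
split=> [cA x y t /andP[t0 t1] Ax Ay|cA x y t].
  by have := cA x y (Itv01 t0 t1); rewrite !inE; exact.
rewrite !inE => Ax Ay; apply: cA => //; apply/andP; split; [exact: ge0|exact: le1].
Qed.

Lemma dotvC (R : realType) d (x y : 'rV[R]_d) : dotv x y = dotv y x.
Proof. by apply: eq_bigr => i _; rewrite mulrC. Qed.

Lemma dotvDl (R : realType) d (a b : R) (x y z : 'rV[R]_d) :
  dotv (a *: x + b *: y) z = a * dotv x z + b * dotv y z.
Proof.
rewrite /dotv !mulr_sumr -big_split; apply: eq_bigr => i _ /=.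
by rewrite !mxE mulrDl !mulrA.
Qed.

Lemma slackC (R : realType) d (x y : 'rV[R]_d) : slack x y = slack y x.
Proof. by rewrite /slack dotvC. Qed.

Lemma slack_conv (R : realType) d (t : R) (x y z : 'rV[R]_d) :
  slack z (t *: x + (1 - t) *: y) = t * slack z x + (1 - t) * slack z y.
Proof. by rewrite /slack !(dotvC z) dotvDl; ring. Qed.

Lemma slack0 (R : realType) d (x : 'rV[R]_d) : slack 0 x = 1.
Proof.
by rewrite /slack /dotv big1 ?subr0// => i _; rewrite mxE mul0r.
Qed.

Lemma polar0 (R : realType) d (S : set 'rV[R]_d) : polar S 0.
Proof. by move=> x _; rewrite dotvC -subr_ge0 -/(slack _ _) slack0. Qed.

Lemma polar_slack (R : realType) d (S : set 'rV[R]_d) y :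
  polar S y <-> forall x, S x -> 0 <= slack y x.
Proof. by split=> h x /h; rewrite /slack subr_ge0 dotvC. Qed.

Lemma polar_convex (R : realType) d (S : set 'rV[R]_d) : convex_set (polar S).
Proof.
apply/convex_setP => x y t /andP[t0 t1] /polar_slack Sx /polar_slack Sy.
apply/polar_slack => z Sz; rewrite slackC slack_conv.
rewrite -subr_ge0 in t1.
by rewrite !(slackC z); apply: addr_ge0; apply: mulr_ge0 => //; [exact: Sx|exact: Sy].
Qed.

Lemma sub_bipolar (R : realType) d (S : set 'rV[R]_d) : S `<=` polar (polar S).
Proof. by move=> x Sx y /(_ x Sx); rewrite dotvC. Qed.

Lemma sub_hull (R : realType) d (S : set 'rV[R]_d) : S `<=` convex_hull S.
Proof. exact: sub_smallest. Qed.

Lemma hull_min (R : realType) d (S A : set 'rV[R]_d) :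
  convex_set A -> S `<=` A -> convex_hull S `<=` A.
Proof. exact: smallest_sub. Qed.

Lemma hull_convex (R : realType) d (S : set 'rV[R]_d) :
  convex_set (convex_hull S).
Proof.
apply/convex_setP => x y t t01 hx hy A [cA SA].
by move/convex_setP : (cA); apply => //; [apply: hx|apply: hy].
Qed.

(** * A minimax principle *)

(** For [f] in [P] put [phi f t := t * f u + (1 - t) * f v]. If no [f] is positive
    at both ends, each [phi f] that is positive at [t] is positive on the whole
    part of the segment on one side of [t]. The set [D] of those [t] where some
    [phi f] with [f v > 0] is positive is thus an initial segment; just at its
    supremum a function [f] with [f u > 0] takes over, and since positivity is
    an open condition the two regions overlap. Two functions positive at a
    common [t], one good at each end, have a positive combination that is
    positive at both ends. *)
Lemma minimax2 (R : realType) (V : lmodType R) (P : set (V -> R)) (u v : V) :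
  (forall f, P f -> forall x y (t : R), 0 <= t <= 1 ->
     f (t *: x + (1 - t) *: y) = t * f x + (1 - t) * f y) ->
  (forall f g (a b : R), P f -> P g -> 0 < a -> 0 < b ->
     P (fun x => a * f x + b * g x)) ->
  (forall t : R, 0 <= t <= 1 -> exists2 f, P f & 0 < f (t *: u + (1 - t) *: v)) ->
  exists f, [/\ P f, 0 < f u & 0 < f v].
Proof.
move=> Paff Pcone Pseg; apply: contrapT => nf.
have {}nf f : P f -> 0 < f u -> f v <= 0.
  by move=> Pf fu; rewrite leNgt; apply/negP => fv; apply: nf; exists f.
pose D := [set t : R | 0 <= t <= 1 /\
  exists f, [/\ P f, 0 < f v & 0 < t * f u + (1 - t) * f v]].
have D1 : ubound D 1 by move=> t [/andP[]].
have D0 : D 0.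
  have t01 : 0 <= (0 : R) <= 1 by rewrite lexx ler01.
  split=> //; have [f Pf] := Pseg 0 t01; rewrite (Paff f)// => f0.
  exists f; split=> //; move: f0; rewrite mul0r add0r subr0 mul1r//.
have supD : has_sup D by split; [exists 0|exists 1].
set s := sup D.
have s01 : 0 <= s <= 1.
  by apply/andP; split; [exact: (ub_le_sup supD.2)|exact: (ge_sup supD.1)].
have [f Pf] := Pseg s s01; rewrite (Paff f)// => fs.
have /andP[s0 s1] := s01.
have [fv|fv] := ltP 0 (f v).
  have fu : f u <= 0.
    by rewrite leNgt; apply/negP => fu; have := nf f Pf fu; rewrite leNgt fv.
  (* the root of [phi f]: [phi f] is positive up to [r], beyond the supremum *)
  pose r := f v / (f v - f u).
  have fvu : 0 < f v - f u by rewrite subr_gt0 (le_lt_trans fu).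
  have rE : r * (f v - f u) = f v by rewrite divfK// gt_eqF.
  have sr : s < r by rewrite -(ltr_pM2r fvu) rE; lra.
  have r1 : r <= 1 by rewrite -(ler_pM2r fvu) rE; lra.
  have : D ((s + r) / 2).
    split; first by apply/andP; split; lra.
    exists f; split=> //.
    have -> : (s + r) / 2 * f u + (1 - (s + r) / 2) * f v =
       ((s * f u + (1 - s) * f v) + (f v - r * (f v - f u))) / 2 by field.
    by rewrite rE subrr addr0 divr_gt0.
  by move/(ub_le_sup supD.2); rewrite -/s; lra.
have fu : 0 < f u.
  rewrite ltNge; apply/negP => fu.
  have : s * f u + (1 - s) * f v <= 0.
    have s'0 : 0 <= 1 - s by rewrite subr_ge0.
    have := mulr_ge0_le0 s0 fu; have := mulr_ge0_le0 s'0 fv; lra.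
  by rewrite leNgt fs.
have fuv : 0 < f u - f v by rewrite subr_gt0 (le_lt_trans fv).
(* the root of [phi f]: [phi f] is positive after [r], before the supremum *)
pose r := - f v / (f u - f v).
have rE : r * (f u - f v) = - f v by rewrite divfK// gt_eqF.
have rs : r < s by rewrite -(ltr_pM2r fuv) rE; lra.
have [t [/andP[t0 t1] [g [Pg gv gt]]] rt] := sup_gt supD.1 rs.
have gu : g u <= 0.
  by rewrite leNgt; apply/negP => gu; have := nf g Pg gu; rewrite leNgt gv.
have ft : 0 < t * f u + (1 - t) * f v.
  by move: rt; rewrite -(ltr_pM2r fuv) rE; lra.
have guv : 0 < g v - g u by rewrite subr_gt0 (le_lt_trans gu).
(* positivity at a common point [t] bounds the slopes; multiply both bounds *)
have det : 0 < f u * g v - f v * g u.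
  have tf : (1 - t) * - f v < t * f u by lra.
  have tg : t * - g u < (1 - t) * g v by lra.
  have t'0 : 0 <= 1 - t by rewrite subr_ge0.
  have fv' : 0 <= - f v by rewrite oppr_ge0.
  have gu' : 0 <= - g u by rewrite oppr_ge0.
  have := ltr_pM (mulr_ge0 t'0 fv') (mulr_ge0 t0 gu') tf tg.
  have -> : (1 - t) * - f v * (t * - g u) = (t * (1 - t)) * (f v * g u) by ring.
  have -> : t * f u * ((1 - t) * g v) = (t * (1 - t)) * (f u * g v) by ring.
  have tt : 0 <= t * (1 - t) by rewrite mulr_ge0.
  by move=> h; rewrite subr_gt0 ltNge; apply/negP => /(ler_wpM2l tt); rewrite leNgt h.
have := nf _ (Pcone _ _ _ _ Pf Pg guv fuv).
have -> : (g v - g u) * f u + (f u - f v) * g u = f u * g v - f v * g u by ring.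
have -> : (g v - g u) * f v + (f u - f v) * g v = f u * g v - f v * g u by ring.
by move=> /(_ det); rewrite leNgt det.
Qed.

(** Points of [s] are treated one at a time: once positivity at [v] has been
    imposed, the remaining functions still form a convex cone, and by the
    two-point case on the segment from [c] to [v] they still reach a positive
    value at every [c] in [C]. *)
Lemma minimax_finite (R : realType) (V : lmodType R) (C : set V) (s : seq V)
    (P : set (V -> R)) :
  convex_set C -> C !=set0 -> (forall x, x \in s -> C x) ->
  (forall f, P f -> forall x y (t : R), 0 <= t <= 1 ->
     f (t *: x + (1 - t) *: y) = t * f x + (1 - t) * f y) ->
  (forall f g (a b : R), P f -> P g -> 0 < a -> 0 < b ->
     P (fun x => a * f x + b * g x)) ->
  (forall c, C c -> exists2 f, P f & 0 < f c) ->
  exists2 f, P f & forall x, x \in s -> 0 < f x.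
Proof.
move=> /convex_setP cC [c0 Cc0].
elim: s P => [|v s IH] P sC Paff Pcone PC.
  by have [f Pf _] := PC _ Cc0; exists f.
have [||||f [Pf fv] fs] := IH [set f | P f /\ 0 < f v].
- by move=> x xs; apply: sC; rewrite inE xs orbT.
- by move=> f [Pf _]; apply: Paff.
- move=> f g a b [Pf fv] [Pg gv] a0 b0; split; first exact: Pcone.
  by rewrite addr_gt0// mulr_gt0.
- move=> c Cc; have [|f [Pf fc fv]] := @minimax2 _ _ P c v Paff Pcone; last by exists f.
  by move=> t t01; apply/PC/cC => //; apply: sC; rewrite mem_head.
by exists f => // x; rewrite inE => /predU1P[->//|]; apply: fs.
Qed.

(** * Separation in the Hilbert metric *)

(** Exceeding [a >= 0] strictly forces the infimum and the supremum to be genuine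
    ones, because [inf] and [sup] of unsuitable sets are 0. *)
Lemma hilbert_dist_witness (R : realType) d (L : set 'rV[R]_d) (a : R)
    (x : 'rV[R]_d) (C : set 'rV[R]_d) (c : 'rV[R]_d) :
  0 <= a -> a < hilbert_dist_set L x C -> C c ->
  exists y z, [/\ polar L y, polar L z &
    2 * a < ln (slack y x / slack y c * (slack z c / slack z x))].
Proof.
move=> a0 aC Cc.
have hi : has_inf [set hilbert_dist L x c | c in C].
  apply: contrapT => /inf_out; rewrite -/(hilbert_dist_set L x C) => h.
  by move: aC; rewrite h ltNge a0.
have : a < hilbert_dist L x c.
  by apply: (lt_le_trans aC); apply: ge_inf; [exact: hi.2|exists c].
rewrite /hilbert_dist; set E := [set _ | _ in _ & _ in _] => aE.
have {}aE : 2 * a < sup E by lra.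
have [|_ [y Ly [z Lz <-]] h] := sup_gt _ aE; last by exists y, z.
by exists (ln (slack 0 x / slack 0 c * (slack 0 c / slack 0 x))), 0;
  [exact: polar0|exists 0 => //; exact: polar0].
Qed.

(** Hahn-Banach separation for the Hilbert metric: a pair of dual points, a priori
    depending on the point [c] of [C], is made uniform in [c]. The condition on
    [(y, z)] is not convex, but it concerns only the rays of [slack y] and
    [slack z]: normalised to agree at [x], the differences
    [t * slack z - expR (2 * a) * (t' * slack y)] form a convex cone, because
    the multiples of the slacks of [polar K] do. The minimax principle applies
    to this cone. *)
Lemma separating_pair (R : realType) d (K : set 'rV[R]_d) (a : R)
    (x : 'rV[R]_d) (C : set 'rV[R]_d) (s : seq 'rV[R]_d) :
  0 <= a -> a < hilbert_dist_set K x C ->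
  convex_set C -> C !=set0 -> (forall c, c \in s -> C c) ->
  (forall y c, polar K y -> C c -> 0 < slack y c) ->
  (forall y, polar K y -> 0 < slack y x) ->
  exists y z, [/\ polar K y, polar K z & forall c, c \in s ->
    expR (2 * a) * (slack y c * slack z x) < slack z c * slack y x].
Proof.
move=> a0 aC cC C0 sC posC posx.
set E := expR (2 * a).
pose Lam := [set f : 'rV[R]_d -> R | exists (t : R) y,
  [/\ 0 < t, polar K y & f = fun c => t * slack y c]].
have LamD f g (p q : R) : Lam f -> Lam g -> 0 < p -> 0 < q ->
    Lam (fun c => p * f c + q * g c).
  move=> [t [y [t0 Ky ->]]] [t' [y' [t'0 Ky' ->]]] p0 q0.
  have pt : 0 < p * t by rewrite mulr_gt0.
  have qt : 0 < q * t' by rewrite mulr_gt0.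
  have pq0 : 0 < p * t + q * t' by rewrite addr_gt0.
  have w1 : 1 - p * t / (p * t + q * t') = q * t' / (p * t + q * t').
    by field; rewrite gt_eqF.
  exists (p * t + q * t'), (p * t / (p * t + q * t') *: y +
     (1 - p * t / (p * t + q * t')) *: y'); split=> //.
    have /convex_setP h := @polar_convex _ _ K; apply: h => //.
    by rewrite divr_ge0 ?(ltW pt) ?(ltW pq0)//= ler_pdivrMr// mul1r lerDl ltW.
  apply/funext => c; rewrite !(slackC _ c) slack_conv w1.
  by field; rewrite gt_eqF.
pose P := [set f : 'rV[R]_d -> R | exists A B,
  [/\ Lam A, Lam B, A x = B x & f = fun c => A c - E * B c]].
have Lam_aff f u v (t : R) : Lam f -> f (t *: u + (1 - t) *: v) = t * f u + (1 - t) * f v.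
  by move=> [p [y [_ _ ->]]]; rewrite slack_conv; ring.
have [|||f [A [B [[p [z [p0 Kz ->]]] [q [y [q0 Ky ->]]] AB ->]]] fs] :=
    @minimax_finite _ _ C s P cC C0 sC.
- move=> _ [A [B [LA LB _ ->]]] u v t _.
  by rewrite !Lam_aff//; ring.
- move=> _ _ p q [A [B [LA LB AB ->]]] [A' [B' [LA' LB' AB' ->]]] p0 q0.
  exists (fun c => p * A c + q * A' c), (fun c => p * B c + q * B' c).
  split; [exact: LamD|exact: LamD|by rewrite AB AB'|].
  by apply/funext => c; ring.
- move=> c Cc; have [y [z [Ky Kz h]]] := hilbert_dist_witness a0 aC Cc.
  have yx := posx _ Ky; have zx := posx _ Kz.
  have yc := posC _ _ Ky Cc; have zc := posC _ _ Kz Cc.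
  exists (fun c => slack y x * slack z c - E * (slack z x * slack y c)).
    exists (fun c => slack y x * slack z c), (fun c => slack z x * slack y c).
    split=> //; last by rewrite mulrC.
    + by exists (slack y x), z.
    + by exists (slack z x), y.
  have r0 : 0 < slack y x / slack y c * (slack z c / slack z x).
    by rewrite mulr_gt0// divr_gt0.
  move: h; rewrite -ltr_expR lnK ?posrE// -/E => h.
  have D0 : 0 < slack z x * slack y c by rewrite mulr_gt0.
  rewrite subr_gt0 -ltr_pdivlMr//; apply: (lt_le_trans h).
  rewrite le_eqVlt; apply/orP; left; apply/eqP; field.
  by rewrite !gt_eqF.
- exists y, z; split=> // c cs; have /= := fs _ cs.
  have zx := posx _ Kz; have yx := posx _ Ky.
  rewrite subr_gt0 -(ltr_pM2r zx).
  have -> : E * (q * slack y c) * slack z x = q * (E * (slack y c * slack z x)).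
    by ring.
  have -> : p * slack z c * slack z x = slack z c * (p * slack z x) by ring.
  by rewrite AB (_ : _ * (q * _) = q * (slack z c * slack y x)) ?ltr_pM2l//; ring.
Qed.

(** * Greatest elements of sets of naturals *)

Lemma max_natP (A : set nat) (b n0 : nat) :
  (forall n, A n -> (n <= b)%N) -> A n0 ->
  A (max_nat A) /\ forall n, A n -> (n <= max_nat A)%N.
Proof.
move=> Ab An0.
have ex : exists n, `[< A n >] by exists n0; apply/asboolP.
have ub n : `[< A n >] -> (n <= b)%N by move=> /asboolP/Ab.
have [m /asboolP Am mub] := ex_maxnP ex ub.
have [|A1 A2] := @xgetPex _ 0%N (A `&` ubound A).
  by exists m; split=> // n An; rewrite leEnat; apply: mub; apply/asboolP.
by split=> // n /A2; rewrite leEnat.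
Qed.

Lemma max_nat_le (A : set nat) (b : nat) :
  (forall n, A n -> (n <= b)%N) -> (max_nat A <= b)%N.
Proof.
move=> Ab; have [[n An]|nA] := pselect (exists n, A n).
  exact/Ab/(max_natP Ab An).1.
by rewrite /max_nat xgetPN// => n [An _]; apply: nA; exists n.
Qed.

(** * Norms of row vectors *)

Lemma coord_le_norm (R : realType) d (x : 'rV[R]_d) i : `|x 0 i| <= `|x|.
Proof.
by rewrite [leRHS]mx_normrE (le_bigmax _ (fun ij => `|x ij.1 ij.2|) (0, i)).
Qed.

Lemma norm_le_coord (R : realType) d (x : 'rV[R]_d) (c : R) :
  0 <= c -> (forall i, `|x 0 i| <= c) -> `|x| <= c.
Proof.
move=> c0 xc; rewrite [leLHS]mx_normrE; apply: bigmax_le => // -[i j] _.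
by rewrite ord1.
Qed.

Lemma norm_lt_coord (R : realType) d (x : 'rV[R]_d) (c : R) :
  0 < c -> (forall i, `|x 0 i| < c) -> `|x| < c.
Proof.
move=> c0 xc; rewrite [ltLHS]mx_normrE; apply: bigmax_lt => // -[i j] _.
by rewrite ord1.
Qed.

Lemma dotv_le_norm (R : realType) d (x y : 'rV[R]_d) :
  dotv x y <= d%:R * (`|x| * `|y|).
Proof.
apply: le_trans (_ : \sum_(i < d) `|x| * `|y| <= _).
  apply: ler_sum => i _; apply: le_trans (ler_norm _) _.
  by rewrite normrM ler_pM// coord_le_norm.
by rewrite sumr_const card_ord mulr_natl.
Qed.

(** Pigeonhole: points in the same cell of a grid of mesh [e] are at distance
    less than [e]. *)
Lemma separated_bounded (R : realType) d (S : set 'rV[R]_d) (C e : R) :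
  (forall x, S x -> `|x| <= C) -> 0 < e ->
  exists B, forall N (x : 'I_N -> 'rV[R]_d), (forall i, S (x i)) ->
    (forall i j : 'I_N, (i < j)%N -> e <= `|x i - x j|) -> (N <= B)%N.
Proof.
move=> SC e0; pose m := Num.trunc (2 * C / e).
exists #|{ffun 'I_d -> 'I_m.+1}| => N x Sx xsep.
have pos i k : 0 <= (x i 0 k + C) / e.
  apply: divr_ge0; last exact: ltW.
  have := le_trans (coord_le_norm (x i) k) (SC _ (Sx i)).
  by rewrite ler_norml => /andP[]; lra.
pose cell i : {ffun 'I_d -> 'I_m.+1} :=
  [ffun k => inord (Num.trunc ((x i 0 k + C) / e))].
suff /leq_card : injective cell by rewrite card_ord.
have far i j : cell i = cell j -> `|x i - x j| < e.
  move=> /ffunP cij; apply: norm_lt_coord => // k.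
  have cellE l : Num.trunc ((x l 0 k + C) / e) = cell l k :> nat.
    rewrite ffunE inordK// ltnS; apply: le_truncn.
    rewrite ler_pM2r ?invr_gt0// mulr_natl mulr2n lerD2r.
    exact: le_trans (ler_norm _) (le_trans (coord_le_norm (x l) k) (SC _ (Sx l))).
  have := truncn_itv (pos i k); have := truncn_itv (pos j k).
  rewrite !cellE cij => /andP[j1 j2] /andP[i1 i2].
  rewrite !mxE -(ltr_pM2r (_ : 0 < e^-1)) ?invr_gt0// divff ?gt_eqF//.
  rewrite -{1}(gtr0_norm (_ : 0 < e^-1)) ?invr_gt0// -normrM.
  have -> : (x i 0 k - x j 0 k) / e = (x i 0 k + C) / e - (x j 0 k + C) / e by ring.
  by move: i1 i2 j1 j2; rewrite -!natr1 ltr_norml; lra.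
move=> i j cij; apply/val_inj/eqP; rewrite eqn_leq; apply/negPn/negP.
rewrite negb_and -!ltnNge => /orP[] /xsep; rewrite leNgt => /negP; apply.
  exact: far.
exact: far.
Qed.

(** * Metric estimates for polar bodies *)

(** Testing [y] on small multiples of the basis vectors bounds its coordinates. *)
Lemma polar_bounded (R : realType) d (S : set 'rV[R]_d) :
  nbhs (0 : 'rV[R]_d) S -> exists2 C : R, 0 < C & forall y, polar S y -> `|y| <= C.
Proof.
move=> /nbhs_ballP[e /= e0 eS]; exists (2 / e); first by rewrite divr_gt0.
move=> y Sy; apply: norm_le_coord => [|i]; first by rewrite divr_ge0 ?ltW.
have key (t : R) : `|t| < e -> t * y 0 i <= 1.
  move=> te; have : S (t *: delta_mx 0 i).
    apply: eS; rewrite -ball_normE /= sub0r normrN.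
    apply: norm_lt_coord => // j; rewrite !mxE normrM (le_lt_trans _ te)//.
    by rewrite ler_piMr// eqxx/=; case: eqP; rewrite ?normr1// normr0.
  move=> /Sy; rewrite /dotv (bigD1 i)//= big1 ?addr0 => [|j /negbTE ji].
    by rewrite !mxE !eqxx mulr1.
  by rewrite !mxE ji andbF mulr0 mul0r.
have e20 : 0 < e / 2 by rewrite divr_gt0.
have e2 : e / 2 < e by lra.
have := key (e / 2); rewrite gtr0_norm// => /(_ e2) h1.
have := key (- (e / 2)); rewrite normrN gtr0_norm// => /(_ e2) h2.
have inv : e / 2 * (2 / e) = 1 by field; rewrite gt_eqF.
by rewrite ler_norml -(ler_pM2l e20) -[X in _ && X](ler_pM2l e20) mulrN inv; lra.
Qed.

Lemma polar_nbhs (R : realType) d (S : set 'rV[R]_d) (C : R) :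
  0 < C -> (forall x, S x -> `|x| <= C) -> nbhs (0 : 'rV[R]_d) (polar S).
Proof.
move=> C0 SC; apply/nbhs_ballP.
have D0 : 0 < d%:R * C + 1 by rewrite ltr_wpDl// mulr_ge0// ltW.
exists (d%:R * C + 1)^-1; first by rewrite /= invr_gt0.
move=> y; rewrite -ball_normE /= sub0r normrN => yD x /SC xC.
apply: le_trans (dotv_le_norm _ _) _.
have : `|y| * (d%:R * C + 1) <= 1 by rewrite -ler_pdivlMr// mul1r ltW.
apply: le_trans; rewrite [leRHS]mulrC mulrA ler_wpM2r//.
rewrite (le_trans (_ : _ <= d%:R * C))//; first by rewrite ler_wpM2l.
by rewrite lerDl.
Qed.

(** Compactness of [G] gives [t > 1] with [t *: G] inside [K]. For [y] in
    [polar K], the point [t *: y] lies in [polar G], hence the inner product of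
    [y] with any [x] in the bipolar of [G] is at most [1 / t]. *)
Lemma polar_margin (R : realType) d (G K : set 'rV[R]_d) :
  compact G -> G `<=` interior K ->
  exists2 e : R, 0 < e & forall x y, polar (polar G) x -> polar K y -> e <= slack x y.
Proof.
move=> /compact_near_coveringP cG GK.
have : \forall t \near (1 : R), G `<=` (fun x => K (t *: x)).
  apply: (cG R (nbhs (1 : R)) (fun t x => K (t *: x))) => x Gx.
  have /(_ (1 : R, x)) := @scale_continuous R 'rV[R]_d.
  move=> /(_ K); rewrite /= scale1r => /(_ (GK _ Gx)).
  move=> [[A B] /= [A1 Bx] AB].
  by exists (B, A) => //= -[u t] /= [Bu At]; apply: (AB (t, u)).
move=> /nbhs_ballP[e /= e0 eG].
have /eG Gt : ball (1 : R) e (1 + e / 2).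
  by rewrite -ball_normE /= opprD addrA subrr sub0r normrN gtr0_norm; lra.
have t0 : 0 < 1 + e / 2 by lra.
exists (1 - (1 + e / 2)^-1).
  by rewrite subr_gt0 invf_lt1//; lra.
move=> x y Gx Ky; rewrite lerD2l lerN2.
rewrite -(ler_pM2l t0) mulfV ?gt_eqF//.
have : polar G ((1 + e / 2) *: y).
  move=> z /Gt /Ky; rewrite /dotv; apply: le_trans; apply: ler_sum => i _.
  by rewrite !mxE mulrCA mulrA.
move=> /Gx; apply: le_trans; rewrite mulr_sumr; apply: ler_sum => i _.
by rewrite !mxE (mulrC (x 0 i)) mulrA.
Qed.

(** * Hilbert geometry of a set well inside a body *)

(** What the packing arguments need of a set [S] well inside a body [L]: positive
    slacks, so that the logarithms in [hilbert_dist L] are meaningful, and a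
    bound on these logarithms, which makes the suprema genuine and compares the
    Hilbert metric with the norm. *)
Definition hilbert_lipschitz (R : realType) d (S L : set 'rV[R]_d) (k : R) :=
  (forall x u, polar L x -> S u -> 0 < slack x u) /\
  (forall x x' u v, polar L x -> polar L x' -> S u -> S v ->
     ln (slack x u / slack x v * (slack x' v / slack x' u)) <= k * `|u - v|).

(** By [ln (1 + r) <= r], the logarithm of a ratio of slacks at [u] and [v] is at
    most their difference divided by the smallest slack. Numerators are
    controlled by the boundedness of the bipolar of [G], denominators by
    [polar_margin]. *)
Lemma polar_hilbert_lipschitz (R : realType) d (G K : set 'rV[R]_d) :
  compact G -> nbhs (0 : 'rV[R]_d) G -> G `<=` interior K ->
  exists2 k : R, 0 < k & hilbert_lipschitz (polar K) (polar G) k.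
Proof.
move=> cG G0 GK.
have [C C0 GC] : exists2 C : R, 0 < C & forall x, G x -> `|x| <= C.
  by have [C [C0 GC]] := pinfty_ex_gt0 (compact_bounded cG); exists C.
have [c c0 xc] := polar_bounded (polar_nbhs C0 GC).
have [e e0 slack_e] := polar_margin cG GK.
have pos x u : polar (polar G) x -> polar K u -> 0 < slack x u.
  by move=> Gx Ku; apply: lt_le_trans e0 (slack_e _ _ Gx Ku).
have k0 : 0 <= d%:R * c / e by rewrite divr_ge0 ?mulr_ge0// ltW.
have half x u v : polar (polar G) x -> polar K u -> polar K v ->
    ln (slack x u / slack x v) <= d%:R * c / e * `|u - v|.
  move=> Gx Ku Kv; have su := pos _ _ Gx Ku; have sv := pos _ _ Gx Kv.
  have rE : slack x u / slack x v = 1 + dotv x (v - u) / slack x v.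
    have -> : dotv x (v - u) = slack x u - slack x v.
      rewrite /slack !(dotvC x) -scaleN1r -[in LHS](scale1r v) dotvDl; ring.
    by field; rewrite gt_eqF.
  rewrite rE (le_trans (le_ln1Dx _))//.
    by rewrite -(ltrD2l 1) subrr -rE divr_gt0.
  rewrite ler_pdivrMr//; apply: le_trans (dotv_le_norm _ _) _.
  have dc0 : 0 <= d%:R * (c * `|u - v|) by rewrite !mulr_ge0// ltW.
  apply: (@le_trans _ _ (d%:R * (c * `|u - v|))).
    by rewrite distrC ler_wpM2l// ler_wpM2r// xc.
  have -> : d%:R * c / e * `|u - v| * slack x v =
      d%:R * (c * `|u - v|) * (slack x v / e) by field; rewrite gt_eqF.
  by rewrite ler_peMr// ler_pdivlMr// mul1r slack_e.
exists (2 * (d%:R * c / e) + 1); first by rewrite ltr_wpDl// mulr_ge0.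
split=> // x x' u v Gx Gx' Ku Kv.
move: (_ / e) half => M half.
have := half x _ _ Gx Ku Kv; have := half x' _ _ Gx' Kv Ku; rewrite (distrC v).
rewrite (@lnM _ (slack x u / _)) ?posrE ?divr_gt0 ?pos//; have := normr_ge0 (u - v); lra.
Qed.

Lemma double_hilbert_dist (R : realType) d (L : set 'rV[R]_d) u v :
  2 * hilbert_dist L u v =
  sup [set ln (slack y u / slack y v * (slack z v / slack z u))
      | y in polar L & z in polar L].
Proof. by rewrite /hilbert_dist mulrA divff// mul1r. Qed.

Lemma hilbert_dist_ge (R : realType) d (S L : set 'rV[R]_d) (k : R) x x' u v :
  hilbert_lipschitz S L k -> polar L x -> polar L x' -> S u -> S v ->
  ln (slack x u / slack x v * (slack x' v / slack x' u)) <= 2 * hilbert_dist L u v.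
Proof.
move=> [pos lip] Lx Lx' Su Sv; rewrite double_hilbert_dist.
apply: ub_le_sup; last by exists x => //; exists x'.
by exists (k * `|u - v|) => _ [y Ly [z Lz <-]]; apply: lip.
Qed.

Lemma hilbert_dist_le (R : realType) d (S L : set 'rV[R]_d) (k : R) u v :
  hilbert_lipschitz S L k -> S u -> S v ->
  2 * hilbert_dist L u v <= k * `|u - v|.
Proof.
move=> [pos lip] Su Sv; rewrite double_hilbert_dist.
apply: ge_sup; last by move=> _ [y Ly [z Lz <-]]; apply: lip.
exists (ln (slack 0 u / slack 0 v * (slack 0 v / slack 0 u))).
by exists 0; [exact: polar0|exists 0 => //; exact: polar0].
Qed.

Lemma hilbert_dist_ge0 (R : realType) d (S L : set 'rV[R]_d) (k : R) u v :
  hilbert_lipschitz S L k -> S u -> S v -> 0 <= hilbert_dist L u v.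
Proof.
move=> SL Su Sv; have := hilbert_dist_ge SL (@polar0 _ _ L) (@polar0 _ _ L) Su Sv.
by rewrite !slack0 !divr1 mulr1 ln1 pmulr_rge0.
Qed.

Lemma hilbert_dist_set_le (R : realType) d (S L C : set 'rV[R]_d) (k : R) u c :
  hilbert_lipschitz S L k -> S u -> C `<=` S -> C c ->
  hilbert_dist_set L u C <= hilbert_dist L u c.
Proof.
move=> SL Su CS Cc; apply: ge_inf; last by exists c.
by exists 0 => _ [v Cv <-]; apply: (hilbert_dist_ge0 SL) => //; apply: CS.
Qed.

(** A single [x] suffices to push [u] away from a whole hull, since the slack at
    [x] is affine: its bound on [T] extends to the hull. The other functional in
    the cross-ratio is taken to be 0, whose slack is constantly 1. *)
Lemma far_from_hull (R : realType) d (S L T : set 'rV[R]_d) (k b : R) x u :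
  hilbert_lipschitz S L k -> convex_set S -> T `<=` S -> T !=set0 ->
  polar L x -> S u ->
  (forall v, T v -> expR (2 * b) * slack x v <= slack x u) ->
  b <= hilbert_dist_set L u (convex_hull T).
Proof.
move=> SL cS TS [v0 Tv0] Lx Su Tu.
apply: lb_le_inf => [|_ [c hc <-]].
  by exists (hilbert_dist L u v0), v0 => //; apply: sub_hull.
pose A := [set v | S v /\ expR (2 * b) * slack x v <= slack x u].
have cA : convex_set A.
  move/convex_setP : (cS) => cS'.
  apply/convex_setP => v w t t01 [Sv vu] [Sw wu]; split; first exact: cS'.
  rewrite slack_conv; have /andP[t0 t1] := t01.
  have t'0 : 0 <= 1 - t by rewrite subr_ge0.
  by have := ler_wpM2l t0 vu; have := ler_wpM2l t'0 wu; lra.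
have [Sc cu] : A c by apply: (hull_min cA _ hc) => v Tv; split; [exact: TS|exact: Tu].
have [pos _] := SL; have xu := pos _ _ Lx Su; have xc := pos _ _ Lx Sc.
have := hilbert_dist_ge SL Lx (@polar0 _ _ L) Su Sc.
rewrite !slack0 divr1 mulr1 => h.
have : 2 * b <= ln (slack x u / slack x c).
  by rewrite -ler_expR lnK ?posrE ?divr_gt0// ler_pdivlMr.
lra.
Qed.

(** Finiteness of packings, so that [hilbert_packing] is a genuine maximum: a lower
    bound on Hilbert distances is one on norms. *)
Lemma packing_max (R : realType) d (S L : set 'rV[R]_d) (k C b : R) :
  hilbert_lipschitz S L k -> 0 < k -> (forall u, S u -> `|u| <= C) -> 0 < b ->
  (exists x : 'I_(hilbert_packing S L b) -> 'rV[R]_d, (forall i, S (x i)) /\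
     forall i j : 'I__, (i < j)%N -> b <= hilbert_dist L (x i) (x j)) /\
  forall N (x : 'I_N -> 'rV[R]_d), (forall i, S (x i)) ->
     (forall i j : 'I_N, (i < j)%N -> b <= hilbert_dist L (x i) (x j)) ->
     (N <= hilbert_packing S L b)%N.
Proof.
move=> SL k0 SC b0.
have e0 : 0 < 2 * b / k by rewrite divr_gt0// mulr_gt0.
have [B HB] := separated_bounded SC e0.
have [||h1 h2] := @max_natP [set N | exists x : 'I_N -> 'rV[R]_d,
    (forall i, S (x i)) /\
    (forall i j : 'I_N, (i < j)%N -> b <= hilbert_dist L (x i) (x j))] B 0%N.
- move=> N [x [Sx xb]]; apply: (HB N x Sx) => i j /xb bij.
  rewrite ler_pdivrMr// mulrC [leRHS]mulrC.
  have := hilbert_dist_le SL (Sx i) (Sx j); lra.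
- by exists (fun=> 0); split; case.
- by split=> // N x Sx xb; apply: h2; exists x.
Qed.

(** A convexified packing is a packing, which bounds its size. *)
Lemma convexified_packing_max (R : realType) d (S L : set 'rV[R]_d) (k C b : R) :
  hilbert_lipschitz S L k -> 0 < k -> (forall u, S u -> `|u| <= C) -> 0 < b ->
  convex_set S ->
  forall N (x : 'I_N -> 'rV[R]_d), (forall i, S (x i)) ->
     (forall j : 'I_N, (0 < j)%N -> b <= hilbert_dist_set L (x j)
                 (convex_hull [set x i | i in [set i : 'I_N | (i < j)%N]])) ->
     (N <= hilbert_convexified_packing S L b)%N.
Proof.
move=> SL k0 SC b0 cS N x Sx xb.
have e0 : 0 < 2 * b / k by rewrite divr_gt0// mulr_gt0.
have [B HB] := separated_bounded SC e0.
have [||h1 h2] := @max_natP [set N | exists x : 'I_N -> 'rV[R]_d,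
    (forall i, S (x i)) /\
    (forall j : 'I_N, (0 < j)%N ->
      b <= hilbert_dist_set L (x j)
                 (convex_hull [set x i | i in [set i : 'I_N | (i < j)%N]]))] B N.
- move=> {}N [{}x [{}Sx {}xb]]; apply: (HB N x Sx) => i j ij.
  rewrite ler_pdivrMr// mulrC [leRHS]mulrC distrC.
  have hS : convex_hull [set x i | i in [set i : 'I_N | (i < j)%N]] `<=` S.
    by apply: hull_min => // _ [l _ <-].
  have := hilbert_dist_le SL (Sx j) (Sx i).
  have := xb j (leq_ltn_trans (leq0n i) ij).
  have := @hilbert_dist_set_le _ _ _ _ _ _ _ (x i) SL (Sx j) hS.
  have /[swap]/[apply] : convex_hull [set x i | i in [set i : 'I_N | (i < j)%N]] (x i).
    by apply: sub_hull; exists i.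
  lra.
- by exists x.
- by apply: h2; exists x.
Qed.

(** * Nets, bins and classes *)

(** The slack at [x] is affine along the segment from [p] to [u], so there are
    points [w i] of it where this slack has grown by the factors
    [expR (2 * b * i)], for [i] up to [ln (slack x u / slack x p) / (2 * b)]. There
    [x] separates each [w i] from the hull of the preceding ones, so these
    points form a convexified packing. *)
Lemma ln_slack_ratio_lt (R : realType) d (S L : set 'rV[R]_d) (k C b : R) x u p :
  hilbert_lipschitz S L k -> 0 < k -> (forall u, S u -> `|u| <= C) -> 0 < b ->
  convex_set S -> polar L x -> S u -> S p ->
  ln (slack x u / slack x p) < 2 * b * (hilbert_convexified_packing S L b)%:R.
Proof.
move=> SL k0 SC b0 cS Lx Su Sp; set n := hilbert_convexified_packing S L b.
have [pos _] := SL; have xu := pos _ _ Lx Su; have xp := pos _ _ Lx Sp.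
rewrite ltNge; apply/negP; set A := slack x u / slack x p => nA.
have A0 : 0 < A by rewrite divr_gt0.
have {}nA : expR (2 * b * n%:R) <= A by rewrite -(lnK A0) ler_expR.
have b2 : 0 <= 2 * b by rewrite mulr_ge0// ltW.
have /choice[s sP] (i : 'I_n.+1) :
    exists s : R, 0 <= s <= 1 /\ s * (A - 1) = expR (2 * b * i%:R) - 1.
  have iA : expR (2 * b * i%:R) <= A.
    by apply: le_trans nA; rewrite ler_expR ler_wpM2l// ler_nat -ltnS.
  have i1 : 1 <= expR (2 * b * i%:R) by rewrite -[leLHS]expR0 ler_expR mulr_ge0.
  (* if [A <= 1], then [A] and [expR (2 * b * i)] are both 1 *)
  have [A1|A1] := leP A 1.
    by exists 0; rewrite lexx ler01; split=> //; lra.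
  have A10 : 0 < A - 1 by rewrite subr_gt0.
  exists ((expR (2 * b * i%:R) - 1) / (A - 1)); split; last by rewrite divfK// gt_eqF.
  rewrite divr_ge0 ?subr_ge0 ?(ltW A1)//= ler_pdivrMr// mul1r; lra.
pose w i := s i *: u + (1 - s i) *: p.
have Sw i : S (w i) by move/convex_setP : (cS); apply => //; exact: (sP i).1.
have xw i : slack x (w i) = expR (2 * b * i%:R) * slack x p.
  have [_ si] := sP i; rewrite slack_conv -[expR _](subrK 1) -si /A.
  by field; rewrite gt_eqF.
suff : (n.+1 <= n)%N by rewrite ltnn.
apply: (convexified_packing_max SL k0 SC b0 cS Sw) => j j0.
apply: (far_from_hull SL cS) Lx (Sw j) _ => [_ [i _ <-]//||_ [i /= ij <-]].
  by exists (w ord0), ord0.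
rewrite !xw mulrA -expRD ler_wpM2r ?(ltW xp)// ler_expR.
by rewrite -[X in X + _]mulr1 -mulrDr ler_wpM2l// nat1r ler_nat.
Qed.

Lemma enum_val_ltn N (J : {set 'I_N}) (i j : 'I_#|J|) :
  (i < j)%N -> (enum_val i < enum_val j)%N.
Proof.
move=> ij; have x0 := enum_val i; rewrite !(enum_val_nth x0).
have srt : sorted (fun a b : 'I_N => (a < b)%N) (enum J).
  rewrite /enum_mem sorted_filter//; first by move=> a b c; apply: ltn_trans.
  by rewrite -enumT; have := iota_ltn_sorted 0 N; rewrite -val_enum_ord sorted_map.
apply: (sorted_ltn_nth _ _ srt) => //; first by move=> a b c; apply: ltn_trans.
- by rewrite inE -cardE.
- by rewrite inE -cardE.
Qed.

(** The hypothesis on [i < j] says that [x i] separates [y i] from every later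
    [y j]; hence the points [y i], taken in decreasing order of [i], form a
    convexified packing. *)
Lemma separated_class_le (R : realType) d (S L : set 'rV[R]_d) (k C b : R) N
    (J : {set 'I_N}) (x y : 'I_N -> 'rV[R]_d) :
  hilbert_lipschitz S L k -> 0 < k -> (forall u, S u -> `|u| <= C) -> 0 < b ->
  convex_set S -> (forall i, polar L (x i)) -> (forall i, S (y i)) ->
  (forall i j, i \in J -> j \in J -> (i < j)%N ->
     expR (2 * b) * slack (x i) (y j) <= slack (x i) (y i)) ->
  (#|J| <= hilbert_convexified_packing S L b)%N.
Proof.
move=> SL k0 SC b0 cS Lx Sy Jxy.
pose e (i : 'I_#|J|) := enum_val (rev_ord i).
apply: (@convexified_packing_max _ _ _ _ _ _ _ SL k0 SC b0 cS _ (y \o e)) => [i|j j0].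
  exact: Sy.
apply: (far_from_hull SL cS) (Lx (e j)) (Sy _) _ => [_ [i _ <-]||_ [i /= ij <-]].
- exact: Sy.
- exists (y (e (Ordinal (leq_ltn_trans (leq0n _) (ltn_ord j))))).
  by exists (Ordinal (leq_ltn_trans (leq0n _) (ltn_ord j))).
- apply: Jxy; rewrite ?enum_valP//; apply: enum_val_ltn => /=.
  by rewrite ltn_sub2l// (leq_ltn_trans ij).
Qed.

Lemma ler_expR_mul (R : realType) (t a c : R) : 0 < a -> 0 < c ->
  (expR t * a <= c) = (t + ln a <= ln c).
Proof.
by move=> a0 c0; rewrite -[in RHS]ler_expR expRD !lnK.
Qed.

Lemma ltr_expR_mul (R : realType) (t a c : R) : 0 < a -> 0 < c ->
  (expR t * a < c) = (t + ln a < ln c).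
Proof.
by move=> a0 c0; rewrite -[in RHS]ltr_expR expRD !lnK.
Qed.

(** A maximal packing is a net. *)
Lemma packing_cover (R : realType) d (S L : set 'rV[R]_d) (k C b : R) :
  hilbert_lipschitz S L k -> 0 < k -> (forall u, S u -> `|u| <= C) -> 0 < b ->
  exists2 p : 'I_(hilbert_packing S L b) -> 'rV[R]_d, (forall i, S (p i)) &
    forall z, S z -> exists i, hilbert_dist L (p i) z < b.
Proof.
move=> SL k0 SC b0; have [[p [Sp pb]] pmax] := packing_max SL k0 SC b0.
exists p => // z Sz; apply: contrapT => nz.
pose q (i : 'I_(hilbert_packing S L b).+1) := oapp p z (unlift ord_max i).
suff : (hilbert_packing S L b < hilbert_packing S L b)%N by rewrite ltnn.
apply: (pmax _ q) => [i|i j]; first by rewrite /q; case: unlift.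
rewrite /q; case: (unliftP ord_max i) => [i'|] ->; last first.
  by move/leq_trans => /(_ _ (leq_ord j)); rewrite ltnn.
rewrite lift_max; case: (unliftP ord_max j) => [j'|] ->.
  by rewrite lift_max /= => /pb.
by move=> _ /=; rewrite leNgt; apply/negP => h; apply: nz; exists i'.
Qed.

(** [separating_pair] for each member of a convexified packing. Nothing is
    required of the first member, for which 0 serves. *)
Lemma separating_family (R : realType) d (G K : set 'rV[R]_d) (a : R) N
    (x : 'I_N -> 'rV[R]_d) :
  0 <= a -> convex_set G ->
  (forall y c, polar K y -> G c -> 0 < slack y c) ->
  (forall i, G (x i)) ->
  (forall j : 'I_N, (0 < j)%N -> a < hilbert_dist_set K (x j)
      (convex_hull [set x i | i in [set i : 'I_N | (i < j)%N]])) ->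
  exists y z : 'I_N -> 'rV[R]_d, [/\ forall j, polar K (y j),
    forall j, polar K (z j) & forall i j : 'I_N, (i < j)%N ->
      expR (2 * a) * (slack (y j) (x i) * slack (z j) (x j)) <
        slack (z j) (x i) * slack (y j) (x j)].
Proof.
move=> a0 cG pos Gx xa.
suff /choice[yz yzP] (j : 'I_N) : exists yz : 'rV[R]_d * 'rV[R]_d,
    [/\ polar K yz.1, polar K yz.2 & forall i : 'I_N, (i < j)%N ->
      expR (2 * a) * (slack yz.1 (x i) * slack yz.2 (x j)) <
        slack yz.2 (x i) * slack yz.1 (x j)].
  by exists (fun j => (yz j).1), (fun j => (yz j).2); split=> [j|j|i j];
    have [] := yzP j => // _ _; apply.
have [j0|j0] := posnP j.
  exists (0, 0); split=> [||i]; [exact: polar0|exact: polar0|].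
  by rewrite j0 ltn0.
have := xa j j0; set T := [set x i | i in _] => xT.
have TG : convex_hull T `<=` G by apply: hull_min => // _ [i _ <-].
have [|c cs|y c Ky /TG|y Ky|y [z [Ky Kz yz]]] := @separating_pair _ _ _ _ _ _
    [seq x i | i : 'I_N <- enum 'I_N & (i < j)%N] a0 xT (@hull_convex _ _ T).
- by exists (x (Ordinal (leq_ltn_trans (leq0n _) (ltn_ord j)))); apply: sub_hull;
    exists (Ordinal (leq_ltn_trans (leq0n _) (ltn_ord j))).
- by move/mapP: cs => [i]; rewrite mem_filter => /andP[ij _] ->;
    apply: sub_hull; exists i.
- exact: pos.
- exact: pos.
- exists (y, z); split=> // i ij; apply: yz; apply: map_f.
  by rewrite mem_filter ij mem_enum.
Qed.

Theorem lemma4p5 (R : realType) (d : nat) (G K : set 'rV[R]_d) (alpha : R) :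
  convex_body G -> convex_body K ->
  interior G 0 -> G `<=` interior K -> 0 < alpha ->
  (hilbert_convexified_packing G K alpha <=
     11 * hilbert_convexified_packing (polar K) (polar G)
            (3%:R * alpha / 16%:R)%R ^ 2
        * hilbert_packing (polar K) (polar G) (3%:R * alpha / 16%:R)%R)%N.
Proof.
move=> [cptG cG _] _ G0 GK alpha0.
set b := 3%:R * alpha / 16%:R.
have b0 : 0 < b by rewrite /b; lra.
have [k k0 SL] := polar_hilbert_lipschitz cptG G0 GK.
have [C _ SC] := polar_bounded (GK _ (interior_subset G0)).
have cS := @polar_convex _ _ K.
set n := hilbert_convexified_packing (polar K) _ _.
set M := hilbert_packing _ _ _.
apply: max_nat_le => N [x [Gx xsep]].
have LG c : G c -> polar (polar G) c := @sub_bipolar _ _ G c.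
have [pos _] := SL.
have posG y c : polar K y -> G c -> 0 < slack y c.
  by move=> Ky Gc; rewrite slackC; apply: pos => //; exact: LG.
(* of the distance [alpha = 16 b / 3] only the part [3 b] is used: a loss of [2 b]
   each for the net and for the bins leaves [2 b] from the exponent [6 b] *)
have [||y [z [Ky Kz yz]]] := @separating_family _ _ _ _ (3 * b) _ _ _ cG posG Gx.
- by rewrite mulr_ge0// ltW.
- by move=> j /xsep; apply: lt_le_trans; rewrite /b; lra.
have [p Kp pcover] := packing_cover SL k0 SC b0.
have /choice[m mP] j := pcover _ (Kz j).
pose a j := ln (slack (x j) (y j) / slack (x j) (p (m j))).
have b2 : 0 < 2 * b by rewrite mulr_gt0.
(* all [a j] lie between [- 2 b n] and [2 b n]: [2 * n] bins of length [2 b] *)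
have /choice[q qP] j : exists q : 'I_(2 * n),
    q%:R <= (a j + 2 * b * n%:R) / (2 * b) < q.+1%:R.
  have aub : a j < 2 * b * n%:R.
    exact: (ln_slack_ratio_lt SL k0 SC b0 cS (LG _ (Gx j))).
  have alb : - (2 * b * n%:R) < a j.
    rewrite ltrNl -lnV ?posrE ?divr_gt0 ?pos//; try exact: LG.
    by rewrite invf_div; apply: (ln_slack_ratio_lt SL k0 SC b0 cS (LG _ (Gx j))).
  have v0 : 0 <= (a j + 2 * b * n%:R) / (2 * b) by rewrite divr_ge0 ?ltW//; lra.
  have qlt : (Num.trunc ((a j + 2 * b * n%:R) / (2 * b)) < 2 * n)%N.
    rewrite truncn_lt_nat// ltr_pdivrMr// natrM; lra.
  by exists (Ordinal qlt); apply: truncn_itv.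
pose class j := (m j, q j).
have classle c : (#|[set j | class j == c]%SET| <= n)%N.
  apply: (@separated_class_le _ _ _ _ _ _ _ _ _ x y SL k0 SC b0 cS _ Ky) => [i|i j].
    exact: LG.
  rewrite !inE => /eqP ic /eqP jc ij.
  have [mij qij] : m j = m i /\ q j = q i by move: ic; rewrite -jc => -[-> ->].
  have Fpos u l : polar K u -> 0 < slack (x l) u.
    by move=> Ku; apply: pos => //; exact: LG.
  rewrite ler_expR_mul ?Fpos//.
  (* three estimates: the separation of [x j] from [x i], the closeness of [z j] to
     [p (m j)], and the closeness of [a i] to [a j]; in logarithms they add up *)
  have := yz i j ij; rewrite !(slackC _ (x _)).
  rewrite ltr_expR_mul ?mulr_gt0 ?Fpos// !lnM ?posrE ?Fpos//.
  have := hilbert_dist_ge SL (LG _ (Gx j)) (LG _ (Gx i)) (Kp (m j)) (Kz j).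
  rewrite lnM ?posrE ?divr_gt0 ?Fpos// !ln_div ?posrE ?Fpos//.
  have := mP j; have /andP[qj1 qj2] := qP j; have /andP[qi1 qi2] := qP i.
  move: qj2 qi1; rewrite qij ltr_pdivrMr// ler_pdivlMr// -natr1.
  rewrite /a !ln_div ?posrE ?Fpos// mij; lra.
rewrite -[N]card_ord -sum1_card (partition_big class xpredT)//=.
apply: (@leq_trans (\sum_(c : 'I_M * 'I_(2 * n)) n)).
  apply: leq_sum => c _; apply: leq_trans (classle c).
  by rewrite -[leqRHS]sum1_card; apply/eq_leq/eq_bigl => j; rewrite inE.
rewrite sum_nat_const card_prod !card_ord.
have -> : (M * (2 * n) * n = 2 * n ^ 2 * M)%N by rewrite -mulnn; ring.
by rewrite !leq_mul.
Qed.
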